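(* Let $n\ge2$, let $\Omega\subset\mathbb{R}^n$ be a domain containing the origin $0$, and let $U$ be an open subset of $\mathcal{S}^{n\times n}$ such that $M+N\in U$ for every $M\in U$ and every positive definite $N\in\mathcal{S}^{n\times n}$. Let $\widetilde L:\mathbb{R}^n\times\mathbb{R}\times\mathbb{R}^n\to\mathcal{S}^{n\times n}$ be locally Lipschitz, and for a $C^2$ function $u$ write $\widetilde A^u:=-\nabla^2u+\widetilde L(\cdot,u,\nabla u)$. Assume that $u\in C^2(\Omega\setminus\{0\})$ satisfies, for some $\bar r>0$ with $B_{\bar r}\subset\Omega$: for every $V\in\mathbb{R}^n$, the function $w(x):=u(x)+V\cdot x$ satisfies $\inf_{B_r\setminus\{0\}}w=\min_{\partial B_r}w$ for all $0<r<\bar r$. Let $v\in C^2(\Omega)$ and assume $$\widetilde A^u\in\overline U\quad\text{in }\Omega\setminus\{0\},\qquad \widetilde A^v\in\mathcal{S}^{n\times n}\setminus U\quad\text{in }\Omega,\qquad u>v\quad\text{in }\Omega\setminus\{0\}.$$ Then $$\liminf_{|x|\to0}(u-v)(x)>0.$$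
   Context: A domain is a bounded connected open set. $\mathcal{S}^{n\times n}$ is the set of real symmetric $n\times n$ matrices. $B_r$ is the open ball of radius $r$ centered at the origin of $\mathbb{R}^n$. $\overline U$ is the closure of $U$ in $\mathcal{S}^{n\times n}$. *)

(* Defs.v *)
From HB Require Import structures.
From mathcomp Require Import all_boot all_order all_algebra.
From mathcomp Require Import all_classical all_reals all_analysis.

Set Implicit Arguments.
Unset Strict Implicit.
Unset Printing Implicit Defensive.

Import Order.TTheory GRing.Theory Num.Theory.
Import numFieldNormedType.Exports.

Local Open Scope classical_set_scope.
Local Open Scope ring_scope.

(* The library norm on 'rV[R]_n is the sup norm; the Euclidean norm is needed
   for the balls B_r.  Both induce the same topology. *)
Definition dot (R : realType) (n : nat) (x y : 'rV[R]_n) : R :=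
  \sum_(i < n) x ord0 i * y ord0 i.

Definition enorm (R : realType) (n : nat) (x : 'rV[R]_n) : R :=
  Num.sqrt (dot x x).

Definition eball (R : realType) (n : nat) (r : R) : set 'rV[R]_n :=
  [set x | enorm x < r].

Definition boundary (T : topologicalType) (A : set T) : set T :=
  closure A `\` interior A.

Definition domain (R : realType) (n : nat) (D : set 'rV[R]_n) : Prop :=
  [/\ bounded_set D, connected D & open D].

Definition symm (R : realType) (n : nat) : set 'M[R]_n :=
  [set M | M^T = M].

Definition posdef (R : realType) (n : nat) (N : 'M[R]_n) : Prop :=
  symm N /\ forall x : 'rV[R]_n, x != 0 -> 0 < (x *m N *m x^T) ord0 ord0.

(* Relative topology of the space of symmetric matrices inside 'M[R]_n. *)
Definition open_in_symm (R : realType) (n : nat) (U : set 'M[R]_n) : Prop :=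
  exists2 W : set 'M[R]_n, open W & U = W `&` @symm R n.

Definition closure_in_symm (R : realType) (n : nat) (U : set 'M[R]_n) :
    set 'M[R]_n :=
  closure U `&` @symm R n.

Definition partial (R : realType) (n : nat) (i : 'I_n) (u : 'rV[R]_n -> R) :
    'rV[R]_n -> R :=
  fun x => 'D_(delta_mx ord0 i) u x.

Definition grad (R : realType) (n : nat) (u : 'rV[R]_n -> R) (x : 'rV[R]_n) :
    'rV[R]_n :=
  \row_i partial i u x.

Definition hessian (R : realType) (n : nat) (u : 'rV[R]_n -> R)
    (x : 'rV[R]_n) : 'M[R]_n :=
  \matrix_(i, j) partial i (partial j u) x.

(* For D open; only the values of u on D matter. *)
Definition C2 (R : realType) (n : nat) (D : set 'rV[R]_n)
    (u : 'rV[R]_n -> R) : Prop :=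
  forall x, D x ->
    [/\ {for x, continuous u},
        forall i, derivable u x (delta_mx ord0 i) /\
          {for x, continuous (partial i u)}
      & forall i j, derivable (partial j u) x (delta_mx ord0 i) /\
          {for x, continuous (partial i (partial j u))}].

Definition locally_lipschitz (R : realType) (V W : normedModType R)
    (f : V -> W) : Prop :=
  forall x : V, exists2 A : set V, nbhs x A & [lipschitz f y | y in A].

(* The matrix - hess u + L(., u, grad u). *)
Definition Amat (R : realType) (n : nat)
    (L : 'rV[R]_n * R * 'rV[R]_n -> 'M[R]_n) (u : 'rV[R]_n -> R)
    (x : 'rV[R]_n) : 'M[R]_n :=
  - hessian u x + L (x, u x, grad u x).

(* [inf_A w = min_B w], the minimum over B being attained.  The infimum is taken
   in the extended reals, as the real [inf] is 0 by default on sets that are not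
   bounded below. *)
Definition inf_eq_min (R : realType) (T : Type) (w : T -> R) (A B : set T) :
    Prop :=
  exists2 y, B y /\ (forall z, B z -> w y <= w z)
    & ereal_inf [set (w x)%:E | x in A] = (w y)%:E.

(* Main.v *)
Require Import Defs.
From HB Require Import structures.
From mathcomp Require Import all_boot all_order all_algebra.
From mathcomp Require Import all_classical all_reals all_analysis.
From mathcomp Require Import ring lra.

Set Implicit Arguments.
Unset Strict Implicit.
Unset Printing Implicit Defensive.

Import Order.TTheory GRing.Theory Num.Theory.
Import numFieldNormedType.Exports.

Local Open Scope classical_set_scope.
Local Open Scope ring_scope.

(* On a small punctured ball, u - v - a.x - eps |x|^2/2 cannot have a negative
   interior minimum when |a| <= eps * delta: there the gradients of u and v differ
   by O(eps delta), so by the Lipschitz bound the difference of the two matrices is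
   at least eps - O(eps delta) > 0, against the ellipticity of U.  Taking
   a = +- eps delta e_i gives u - v >= c |x|.  By the minimum condition on u
   with V = - grad v 0, the value of u + V.x on the punctured ball then exceeds v 0
   by at least a positive constant. *)

(** * Mean values along lines, and the entrywise sup norm *)

Lemma derive_line (R : realType) (V : normedModType R) (f : V -> R) (z w : V)
    (t : R) : derivable f (z + t *: w) w ->
  is_derive t 1 (fun s => f (z + s *: w)) ('D_w f (z + t *: w)).
Proof.
have E : (fun h : R => h^-1 *: (((fun s => f (z + s *: w)) \o shift t) (h *: 1)
    - f (z + t *: w))) =
  (fun h : R => h^-1 *: ((f \o shift (z + t *: w)) (h *: w) - f (z + t *: w))).
  apply/funext => h /=; rewrite /shift /=; congr (_ *: (f _ - _)).
  by rewrite [h *: 1]mulr1 scalerDl addrCA.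
by move=> fw; split; rewrite /derivable /derive E.
Qed.

(** The increment [c] may have either sign, because coordinate increments do. The intermediate point
    is therefore located only by [|s| <= |c|]. *)
Lemma MVT_line (R : realType) (V : normedModType R) (f : V -> R) (z w : V)
    (c : R) : (forall s : R, `|s| <= `|c| -> derivable f (z + s *: w) w) ->
  exists2 s, `|s| <= `|c| & f (z + c *: w) - f z = c * 'D_w f (z + s *: w).
Proof.
move=> df; pose g (s : R) := f (z + s *: w).
have dg (s : R) : `|s| <= `|c| -> is_derive s 1 g ('D_w f (z + s *: w)).
  by move=> /df; exact: derive_line.
have cg (a b : R) : (forall s : R, s \in `[a, b] -> `|s| <= `|c|) ->
    {within `[a, b], continuous g}.
  move=> ab; apply: derivable_within_continuous => s /ab sc.
  by have [] := dg _ sc.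
have [c0|/ltW c0] := leP 0 c.
  have sc (s : R) : s \in `[0, c] -> `|s| <= `|c|.
    by rewrite in_itv/= => /andP[s0 sc]; rewrite !ger0_norm.
  have [||s sI E] := @MVT_segment _ g (fun s => 'D_w f (z + s *: w)) 0 c c0.
  - by move=> s sI; apply/dg/sc; exact: subset_itv_oo_cc sI.
  - exact: cg.
  exists s; first exact: sc.
  by move: E; rewrite /g scale0r addr0 subr0 mulrC.
have sc (s : R) : s \in `[c, 0] -> `|s| <= `|c|.
  by rewrite in_itv/= => /andP[s0 sc]; rewrite !ler0_norm// lerN2.
have [||s sI E] := @MVT_segment _ g (fun s => 'D_w f (z + s *: w)) c 0 c0.
- by move=> s sI; apply/dg/sc; exact: subset_itv_oo_cc sI.
- exact: cg.
exists s; first exact: sc.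
by move: E; rewrite /g scale0r addr0 sub0r mulrN mulrC => /eqP;
  rewrite -opprB eqr_opp => /eqP.
Qed.

Lemma mx_norm_le (R : realType) m n (A : 'M[R]_(m, n)) (c : R) : 0 <= c ->
  (`|A| <= c) <-> (forall i j, `|A i j| <= c).
Proof.
move=> c0; split=> [Ac i j|Ac].
  apply: le_trans Ac; rewrite [leRHS]/Num.Def.normr /= mx_normrE.
  by apply/bigmax_geP; right => /=; exists (i, j).
by rewrite [leLHS]/Num.Def.normr /= mx_normrE bigmax_le// => -[i j] _ /=.
Qed.

Lemma entry_le_norm (R : realType) m n (A : 'M[R]_(m, n)) i j :
  `|A i j| <= `|A|.
Proof. by move: i j; apply/mx_norm_le. Qed.

(** * Taylor expansions from continuous partial derivatives *)

(** Walk from [x] to [x + y] one coordinate at a time. The mean value theorem turns each step into a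
    partial derivative at a nearby point, which continuity compares with the one at [x]. *)
Lemma first_order_expansion (R : realType) n (f : 'rV[R]_n -> R)
    (x : 'rV[R]_n) :
  (\forall z \near x, forall i, derivable f z (delta_mx ord0 i)) ->
  (forall i, {for x, continuous (partial i f)}) ->
  forall e : R, 0 < e ->
  \forall y \near (0 : 'rV[R]_n),
    `|f (x + y) - f x - dot y (grad f x)| <= e * `|y|.
Proof.
move=> df cf e e0.
(* There are [n] steps, each with error [e / n.+1]. The successor keeps the quotient meaningful when
   [n = 0]. *)
have e'0 : 0 < e / n.+1%:R by rewrite divr_gt0.
have cfn : \forall z \near x, forall i,
    `|partial i f z - partial i f x| <= e / n.+1%:R.
  apply: (@filter_forall _ _ (fun i z =>
    `|partial i f z - partial i f x| <= e / n.+1%:R) (nbhs x) _ _) => i; have /cvgrPdist_le/(_ _ e'0) := cf i.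
  by apply: filterS => z; rewrite distrC.
have /nbhs_normP[d /= d0 xd] : \forall z \near x,
   (forall i, derivable f z (delta_mx ord0 i)) /\
   (forall i, `|partial i f z - partial i f x| <= e / n.+1%:R).
  exact: filterI.
apply/nbhs_normP; exists d => //= y; rewrite /ball_ /= sub0r normrN => yd.
(* [p k] keeps the first [k] coordinates of [y], so [p 0 = 0] and [p n = y]. In the sup norm the
   whole path stays within [|y|] of [x]. *)
pose p k : 'rV[R]_n := \row_i (if (i < k)%N then y ord0 i else 0).
have step (k : 'I_n) :
  `|f (x + p k.+1) - f (x + p k) - y ord0 k * partial k f x|
    <= e / n.+1%:R * `|y|.
  have pS : x + p k.+1 = x + p k + y ord0 k *: delta_mx ord0 k.
    rewrite -addrA; congr (_ + _); apply/rowP => j; rewrite !mxE eqxx /= ltnS.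
    case: (ltngtP j k) => [jk|jk|/val_inj ->].
    - by rewrite -val_eqE ltn_eqF// mulr0 addr0.
    - by rewrite -val_eqE gtn_eqF// mulr0 addr0.
    - by rewrite eqxx mulr1 add0r.
  have near_x (s : R) : `|s| <= `|y ord0 k| ->
      `|x - (x + p k + s *: delta_mx ord0 k)| < d.
    move=> sy; apply: le_lt_trans yd; rewrite -addrA opprD addNKr normrN.
    apply/mx_norm_le => // i j; rewrite !mxE (_ : i == ord0) /=; last by rewrite [i]ord1.
    case: (ltngtP j k) => [jk|jk|/val_inj ->].
    - by rewrite -val_eqE ltn_eqF// mulr0 addr0; exact: entry_le_norm.
    - by rewrite -val_eqE gtn_eqF// mulr0 addr0 normr0.
    - by rewrite eqxx mulr1 add0r (le_trans sy)// entry_le_norm.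
  have [s /near_x /xd [/(_ k)]//|s sy E] := @MVT_line _ _ f (x + p k)
     (delta_mx ord0 k) (y ord0 k).
  rewrite pS E -/(partial k f _) -mulrBr normrM mulrC ler_pM//.
    by have [_] := xd _ (near_x _ sy).
  exact: entry_le_norm.
have -> : f (x + y) - f x - dot y (grad f x) =
    \sum_(k < n) (f (x + p k.+1) - f (x + p k) - y ord0 k * partial k f x).
  rewrite [RHS]sumrB; congr (_ - _); last first.
    by apply: eq_bigr => k _; rewrite mxE.
  rewrite -(big_mkord xpredT (fun k => f (x + p k.+1) - f (x + p k))).
  rewrite telescope_sumr//; congr (f _ - f _).
    by congr (_ + _); apply/rowP => j; rewrite mxE ltn_ord.
  by rewrite -[LHS]addr0; congr (_ + _); apply/rowP => j; rewrite !mxE ltn0.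
apply: le_trans (ler_norm_sum _ _ _) _.
apply: le_trans (ler_sum _ (fun k _ => step k)) _.
rewrite sumr_const card_ord -(mulr_natl _ n) mulrA ler_wpM2r//.
rewrite mulrCA ger_pMr// ler_pdivrMr// mul1r ler_nat; exact: leqnSn.
Qed.

Lemma is_derive_dot_grad (R : realType) n (f : 'rV[R]_n -> R) (x w : 'rV[R]_n) :
  (\forall z \near x, forall i, derivable f z (delta_mx ord0 i)) ->
  (forall i, {for x, continuous (partial i f)}) ->
  is_derive x w f (dot w (grad f x)).
Proof.
move=> df cf.
have dotZ (h : R) : dot (h *: w) (grad f x) = h * dot w (grad f x).
  by rewrite /dot mulr_sumr; apply: eq_bigr => i _; rewrite mxE mulrA.
suff lim_w : (fun h : R => h^-1 *: ((f \o shift x) (h *: w) - f x)) @ 0^' -->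
    dot w (grad f x).
  by split; [apply/cvg_ex; eexists; exact: lim_w|exact: cvg_lim].
apply/cvgrPdist_le => /= e e0.
(* Dividing by [1 + |w|] instead of [|w|] covers [w = 0] as well. *)
have w0 : 0 < 1 + `|w| by rewrite ltr_pwDl.
have /nbhs_normP[d /= d0 Hd] :=
  first_order_expansion df cf (divr_gt0 e0 w0).
apply/nbhs_ballP; exists (d / (1 + `|w|)) => /=; first exact: divr_gt0.
move=> h /=; rewrite /ball /= sub0r normrN => hd h0.
have hn0 : 0 < `|h| by rewrite normr_gt0.
have hwd : `|h *: w| < d.
  rewrite normrZ; move: hd; rewrite ltr_pdivlMr// => /(le_lt_trans _); apply.
  by rewrite ler_wpM2l// lerDr.
have := Hd (h *: w); rewrite /ball_ /= sub0r normrN => /(_ hwd).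
rewrite dotZ /shift (addrC _ x) => hE.
rewrite -(ler_pM2l hn0) -normrM mulrBr distrC [h * (_ *: _)]mulrA divff// mul1r.
apply: le_trans hE _; rewrite normrZ mulrCA ler_wpM2l// -mulrA ger_pMr//.
by rewrite mulrC ler_pdivrMr// mul1r lerDr.
Qed.

(** * First- and second-order conditions at a minimum *)

(** If [k < 0], then [g'] is negative just to the right of 0 and the mean value theorem gives
    [g b < g 0]. The last hypothesis encodes both [g' 0 = 0] (take [s = 0]) and that [g'] has
    derivative [k] at 0. *)
Lemma second_derivative_ge0_at_min (R : realType) (g g' : R -> R) (k d : R) :
  0 < d -> (forall s : R, `|s| < d -> is_derive s 1 g (g' s)) ->
  (forall s : R, `|s| < d -> g 0 <= g s) ->
  (forall e : R, 0 < e -> \forall s \near 0, `|g' s - k * s| <= e * `|s|) ->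
  0 <= k.
Proof.
move=> d0 dg gmin gk; rewrite leNgt; apply/negP => k0.
(* With this tolerance, [g' s <= k * s / 2 < 0] for small [s > 0]. *)
have k20 : 0 < - k / 2 by lra.
have /nbhs_normP[r /= r0 gr] := gk _ k20.
pose b := Num.min d r / 2.
have b0 : 0 < b by rewrite divr_gt0// lt_min d0 r0.
have bd : b < d.
  by have : Num.min d r <= d; [rewrite ge_min lexx|move: b0; rewrite /b; lra].
have br : b < r.
  have : Num.min d r <= r by rewrite ge_min lexx orbT.
  by move: b0; rewrite /b; lra.
have Ib s : s \in `[0, b] -> `|s| <= b.
  by rewrite in_itv /= => /andP[? ?]; rewrite ger0_norm.
have [||s sI E] := @MVT _ g g' 0 b b0.
- move=> s sI; apply: dg; apply: le_lt_trans bd; apply: Ib.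
  exact: subset_itv_oo_cc sI.
- apply: derivable_within_continuous => s sI.
  by have [] := dg _ (le_lt_trans (Ib _ sI) bd).
have : g b < g 0.
  rewrite -subr_lt0 E subr0 pmulr_llt0//.
  move: (sI); rewrite in_itv /= => /andP[s0 sb].
  have := gr s; rewrite /ball_ /= sub0r normrN gtr0_norm//.
  move=> /(_ (lt_trans sb br)); rewrite ler_norml => /andP[_].
  have : k * s < 0 by rewrite nmulr_rlt0.
  lra.
by apply/negP; rewrite -leNgt gmin// gtr0_norm.
Qed.

Lemma C2_is_derive_line (R : realType) n (D : set 'rV[R]_n) (f : 'rV[R]_n -> R)
    (x w : 'rV[R]_n) (t : R) : open D -> C2 D f -> D (x + t *: w) ->
  is_derive t 1 (fun s => f (x + s *: w)) (dot w (grad f (x + t *: w))).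
Proof.
move=> oD fC2 Dx; have [_ fx _] := fC2 _ Dx.
have dfw : is_derive (x + t *: w) w f (dot w (grad f (x + t *: w))).
  apply: is_derive_dot_grad => [|i]; last by have [] := fx i.
  apply: filterS (open_nbhs_nbhs (conj oD Dx)) => z Dz i.
  by have [_ /(_ i)[]] := fC2 _ Dz.
have [df <-] := dfw.
exact: derive_line.
Qed.

Lemma C2_grad_expansion (R : realType) n (D : set 'rV[R]_n)
    (f : 'rV[R]_n -> R) (x w : 'rV[R]_n) : open D -> C2 D f -> D x ->
  forall e : R, 0 < e -> \forall s \near (0 : R),
    `|dot w (grad f (x + s *: w)) - dot w (grad f x)
      - (w *m hessian f x *m w^T) ord0 ord0 * s| <= e * `|s|.
Proof.
move=> oD fC2 Dx e e0; have [_ _ fx] := fC2 _ Dx.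
have w0 : 0 < 1 + `|w| by rewrite ltr_pwDl.
(* One factor [1 + |w|] absorbs the weight [w_j], the other the length of [s *: w], and [n.+1] the
   sum over [j]. *)
pose e' := e / (n.+1%:R * (1 + `|w|) ^+ 2).
have e'0 : 0 < e' by rewrite divr_gt0// mulr_gt0// exprn_gt0.
have expand j : \forall y \near (0 : 'rV[R]_n), `|partial j f (x + y)
    - partial j f x - dot y (grad (partial j f) x)| <= e' * `|y|.
  apply: first_order_expansion => // [|i]; last by have [] := fx i j.
  apply: filterS (open_nbhs_nbhs (conj oD Dx)) => z Dz i.
  by have [_ _ /(_ i j)[]] := fC2 _ Dz.
have /nbhs_normP[d /= d0 Hd] : \forall y \near (0 : 'rV[R]_n), forall j,
    `|partial j f (x + y) - partial j f x - dot y (grad (partial j f) x)|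
    <= e' * `|y|.
  exact: (@filter_forall _ _ (fun j y => `|partial j f (x + y)
    - partial j f x - dot y (grad (partial j f) x)| <= e' * `|y|)
    (nbhs (0 : 'rV[R]_n)) _ _).
apply/nbhs_ballP; exists (d / (1 + `|w|)) => /=; first exact: divr_gt0.
move=> s; rewrite /ball /= sub0r normrN => sd.
have swd : `|s *: w| < d.
  rewrite normrZ; move: sd; rewrite ltr_pdivlMr// => /(le_lt_trans _); apply.
  by rewrite ler_wpM2l// lerDr.
have := Hd (s *: w); rewrite /ball_ /= sub0r normrN => /(_ swd) sE.
have -> : dot w (grad f (x + s *: w)) - dot w (grad f x)
      - (w *m hessian f x *m w^T) ord0 ord0 * s =
   \sum_j w ord0 j * (partial j f (x + s *: w) - partial j f x
      - dot (s *: w) (grad (partial j f) x)).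
  rewrite /dot mxE mulr_suml -!sumrB; apply: eq_bigr => j _.
  rewrite !mxE !mulrBr; congr (_ - _); rewrite mulrAC mulrC; congr (_ * _).
  by rewrite mulr_suml; apply: eq_bigr => i _; rewrite !mxE; ring.
apply: le_trans (ler_norm_sum _ _ _) _.
have step j : `|w ord0 j * (partial j f (x + s *: w) - partial j f x
      - dot (s *: w) (grad (partial j f) x))|
    <= e / n.+1%:R * `|s|.
  have -> : e / n.+1%:R * `|s| = (1 + `|w|) * (e' * (`|s| * (1 + `|w|))).
    by rewrite /e'; field; rewrite (gt_eqF w0) addrC natr1 pnatr_eq0.
  rewrite normrM ler_pM//.
    by rewrite (le_trans (entry_le_norm _ _ _))// lerDr.
  apply: le_trans (sE _) _; rewrite normrZ ler_wpM2l ?(ltW e'0)// ler_wpM2l//.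
  by rewrite lerDr.
apply: le_trans (ler_sum _ (fun j _ => step j)) _.
rewrite sumr_const card_ord -(mulr_natl _ n) mulrA ler_wpM2r//.
rewrite mulrCA ger_pMr// ler_pdivrMr// mul1r ler_nat; exact: leqnSn.
Qed.

Lemma dotC (R : realType) n (x y : 'rV[R]_n) : dot x y = dot y x.
Proof. by apply: eq_bigr => i _; rewrite mulrC. Qed.

Lemma dotDr (R : realType) n (x y z : 'rV[R]_n) :
  dot x (y + z) = dot x y + dot x z.
Proof.
by rewrite /dot -big_split; apply: eq_bigr => i _; rewrite mxE mulrDr.
Qed.

Lemma dotZr (R : realType) n (c : R) (x y : 'rV[R]_n) :
  dot x (c *: y) = c * dot x y.
Proof. by rewrite /dot mulr_sumr; apply: eq_bigr => i _; rewrite mxE mulrCA. Qed.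

Lemma dot_deltal (R : realType) n (i : 'I_n) (x : 'rV[R]_n) :
  dot (delta_mx ord0 i) x = x ord0 i.
Proof.
rewrite /dot (bigD1 i)//= mxE !eqxx mul1r big1 ?addr0// => j /negbTE ji.
by rewrite mxE ji andbF mul0r.
Qed.

(** Restrict [phi] to each line through [x]. The vanishing first derivative gives the gradient
    identity, and the nonnegative second derivative gives the Hessian bound. *)
Lemma grad_hessian_at_min (R : realType) n (D : set 'rV[R]_n)
    (u v : 'rV[R]_n -> R) (a x : 'rV[R]_n) (eps : R) :
  open D -> C2 D u -> C2 D v -> D x ->
  let phi z := u z - v z - dot a z - eps / 2 * dot z z in
  (\forall z \near x, phi x <= phi z) ->
  grad u x - grad v x = a + eps *: x /\
  (forall w, eps * dot w w
    <= (w *m (hessian u x - hessian v x) *m w^T) ord0 ord0).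
Proof.
move=> oD uC2 vC2 Dx phi phimin.
have /nbhs_normP[r /= r0 rP] : \forall z \near x, D z /\ phi x <= phi z.
  by apply: filterI => //; exact: open_nbhs_nbhs.
suff test w : dot w (grad u x) - dot w (grad v x) = dot w a + eps * dot w x /\
    eps * dot w w <= (w *m (hessian u x - hessian v x) *m w^T) ord0 ord0.
  split=> [|w]; last by have [] := test w.
  apply/rowP => i; have [+ _] := test (delta_mx ord0 i).
  by rewrite !dot_deltal !mxE => ->.
have w0 : 0 < 1 + `|w| by rewrite ltr_pwDl.
pose d := r / (1 + `|w|).
have d0 : 0 < d by exact: divr_gt0.
have line (s : R) : `|s| < d -> D (x + s *: w) /\ phi x <= phi (x + s *: w).
  move=> sd; apply: rP; rewrite /ball_ /= opprD addNKr normrN normrZ.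
  move: sd; rewrite ltr_pdivlMr// => /(le_lt_trans _); apply.
  by rewrite ler_wpM2l// lerDr.
pose c1 := dot a w + eps * dot w x.
pose c2 := eps / 2 * dot w w.
(* [P] is [a.z + eps |z|^2 / 2] along the line [z = x + s *: w], written as a polynomial in [s]. *)
pose P : R -> R := cst (dot a x + eps / 2 * dot x x) + c1 *: id + c2 *: (id * id).
pose g : R -> R := (fun s => u (x + s *: w)) - (fun s => v (x + s *: w)) - P.
pose g' (s : R) := dot w (grad u (x + s *: w)) - dot w (grad v (x + s *: w))
   - (c1 + 2 * c2 * s).
have gE s : g s = phi (x + s *: w).
  rewrite /g /phi /P !fctE /= /c1 /c2 !dotDr !dotZr ![dot (x + _) _]dotC.
  by rewrite !dotDr !dotZr (dotC x w) /GRing.scale /=; field.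
have dg (s : R) : `|s| < d -> is_derive s 1 g (g' s).
  move=> /line[Ds _].
  have du := C2_is_derive_line oD uC2 Ds.
  have dv := C2_is_derive_line oD vC2 Ds.
  have dP : is_derive s 1 P (c1 + 2 * c2 * s).
    have did : is_derive s (1 : R) (id : R -> R) 1 := is_derive_id s (1 : R).
    have := is_deriveD (is_deriveD (is_derive_cst
      (dot a x + eps / 2 * dot x x : R) s (1 : R)) (is_deriveZ c1 did))
      (is_deriveZ c2 (is_deriveM did did)).
    by move/is_derive_eq; apply; rewrite /GRing.scale /=; ring.
  exact: is_deriveB (is_deriveB du dv) dP.
have gmin (s : R) : `|s| < d -> g 0 <= g s.
  by move=> /line[_]; rewrite !gE scale0r addr0.
have g'0 : g' 0 = 0.
  have Id s : s \in `]- d, d[ -> `|s| < d by rewrite in_itv /= ltr_norml.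
  have dg0 : is_derive (0 : R) 1 g 0.
    apply: (@derive1_at_min _ g (- d) d) => [|s /Id/dg[]//||s /Id/gmin//].
      by lra.
    by rewrite in_itv /= oppr_lt0 d0.
  have [_ <-] := dg 0 ltac:(by rewrite normr0).
  by have [_ ->] := dg0.
split.
  move: g'0; rewrite /g' scale0r addr0 mulr0 addr0 /c1 (dotC a w).
  by move/eqP; rewrite subr_eq0 => /eqP.
have [qu quE us] : exists2 q, (w *m hessian u x *m w^T) ord0 ord0 = q &
    forall e : R, 0 < e -> \forall s \near (0 : R),
    `|dot w (grad u (x + s *: w)) - dot w (grad u x) - q * s| <= e * `|s|.
  by eexists; [reflexivity|exact: C2_grad_expansion w oD uC2 Dx].
have [qv qvE vs] : exists2 q, (w *m hessian v x *m w^T) ord0 ord0 = q &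
    forall e : R, 0 < e -> \forall s \near (0 : R),
    `|dot w (grad v (x + s *: w)) - dot w (grad v x) - q * s| <= e * `|s|.
  by eexists; [reflexivity|exact: C2_grad_expansion w oD vC2 Dx].
have -> : (w *m (hessian u x - hessian v x) *m w^T) ord0 ord0 = qu - qv.
  by rewrite -quE -qvE mulmxBr mulmxBl mxE [X in _ + X]mxE.
have c2E : 2 * c2 = eps * dot w w by rewrite /c2; field.
rewrite -subr_ge0 -c2E.
(* The slope of [g'] at 0 is [qu - qv - 2 * c2]. The expansions of the two gradients each contribute
   half of the allowed error. *)
apply: (second_derivative_ge0_at_min d0 dg gmin) => e e0.
have e20 : 0 < e / 2 by exact: divr_gt0.
apply: filterS2 (us _ e20) (vs _ e20) => s {}us {}vs.
have c1E : dot w (grad u x) - dot w (grad v x) = c1.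
  by move/eqP: g'0; rewrite /g' scale0r addr0 mulr0 addr0 subr_eq0 => /eqP.
have -> : g' s - (qu - qv - 2 * c2) * s =
   (dot w (grad u (x + s *: w)) - dot w (grad u x) - qu * s)
   - (dot w (grad v (x + s *: w)) - dot w (grad v x) - qv * s).
  by rewrite /g' -c1E; ring.
apply: le_trans (ler_normB _ _) _.
by apply: le_trans (lerD us vs) _; rewrite -mulrDl -splitr.
Qed.

(** * Quadratic forms and ellipticity *)

Lemma dot_ge0 (R : realType) n (x : 'rV[R]_n) : 0 <= dot x x.
Proof. by apply: sumr_ge0 => i _; rewrite -expr2 sqr_ge0. Qed.

Lemma sqr_entry_le_dot (R : realType) n (x : 'rV[R]_n) i :
  x ord0 i ^+ 2 <= dot x x.
Proof.
rewrite /dot (bigD1 i)//= -expr2 lerDl sumr_ge0// => j _.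
by rewrite -expr2 sqr_ge0.
Qed.

Lemma dot_gt0 (R : realType) n (x : 'rV[R]_n) : x != 0 -> 0 < dot x x.
Proof.
case/rV0Pn => i xi0; apply: lt_le_trans (sqr_entry_le_dot x i).
by rewrite exprn_even_gt0.
Qed.

Lemma dot_le_norm (R : realType) n (x y : 'rV[R]_n) :
  `|dot x y| <= n%:R * `|x| * `|y|.
Proof.
apply: le_trans (ler_norm_sum _ _ _) _.
have step i : `|x ord0 i * y ord0 i| <= `|x| * `|y|.
  by rewrite normrM ler_pM ?entry_le_norm.
apply: le_trans (ler_sum _ (fun i _ => step i)) _.
by rewrite sumr_const card_ord -(mulr_natl (_ * _) n) mulrA.
Qed.

Lemma norm_le_enorm (R : realType) n (x : 'rV[R]_n) : `|x| <= enorm x.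
Proof.
apply/mx_norm_le => [|i j]; first exact: sqrtr_ge0.
by rewrite ord1 -sqrtr_sqr ler_sqrt ?dot_ge0// sqr_entry_le_dot.
Qed.

(** Apply [|w_i w_j| <= (w_i^2 + w_j^2) / 2] to each entry and sum. The factor [n] comes from
    measuring [E] by its largest entry. *)
Lemma quadratic_form_le (R : realType) n (E : 'M[R]_n) (w : 'rV[R]_n) :
  `|(w *m E *m w^T) ord0 ord0| <= n%:R * `|E| * dot w w.
Proof.
have -> : (w *m E *m w^T) ord0 ord0 =
    \sum_j \sum_i w ord0 i * E i j * w ord0 j.
  by rewrite mxE; apply: eq_bigr => j _; rewrite !mxE mulr_suml.
have step i j : `|w ord0 i * E i j * w ord0 j|
    <= `|E| / 2 * (w ord0 i * w ord0 i + w ord0 j * w ord0 j).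
  rewrite mulrAC mulrC normrM -mulrA ler_pM ?entry_le_norm//.
  rewrite ler_norml; have := sqr_ge0 (w ord0 i + w ord0 j).
  have := sqr_ge0 (w ord0 i - w ord0 j); rewrite !expr2; lra.
apply: le_trans (ler_norm_sum _ _ _) _.
apply: le_trans (ler_sum _ (fun j _ => ler_norm_sum _ _ _)) _.
apply: le_trans (ler_sum _ (fun j _ => ler_sum _ (fun i _ => step i j))) _.
have row j : \sum_(i < n) `|E| / 2 *
    (w ord0 i * w ord0 i + w ord0 j * w ord0 j) =
    `|E| / 2 * (dot w w + n%:R * (w ord0 j * w ord0 j)).
  by rewrite -mulr_sumr big_split /= sumr_const card_ord -(mulr_natl (_ * _) n).
rewrite (eq_bigr _ (fun j _ => row j)) -mulr_sumr big_split /= sumr_const.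
rewrite card_ord -(mulr_natl _ n) -mulr_sumr -/(dot w w).
by move: (dot w w) `|E| => q e; rewrite le_eqVlt; apply/orP; left; apply/eqP; field.
Qed.

(** Approximate [A] by some [M] in [U], closely enough that [B - M] stays positive definite. Then
    [B = M + (B - M)] lies in [U]. *)
Lemma closure_add_posdef (R : realType) n (U : set 'M[R]_n) (A B : 'M[R]_n)
    (c : R) : U `<=` @symm R n ->
  (forall M N : 'M[R]_n, U M -> posdef N -> U (M + N)) ->
  closure U A -> symm B -> 0 < c ->
  (forall w, c * dot w w <= (w *m (B - A) *m w^T) ord0 ord0) -> U B.
Proof.
move=> Usymm Upos UA symB c0 cBA.
have c'0 : 0 < c / n.+1%:R by exact: divr_gt0.
have [M [UM]] := UA _ (nbhsx_ballx A _ c'0).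
rewrite -ball_normE /ball_ /= => AM.
rewrite -(subrK M B) addrC; apply: Upos => //; split.
  by rewrite /symm /= linearB /= (Usymm _ UM) symB.
move=> w w0.
have -> : (w *m (B - M) *m w^T) ord0 ord0 =
    (w *m (B - A) *m w^T) ord0 ord0 + (w *m (A - M) *m w^T) ord0 ord0.
  by rewrite -(subrKA A) mulmxDr mulmxDl mxE.
have dw := dot_gt0 w0.
have := quadratic_form_le (A - M) w; rewrite ler_norml => /andP[AMw _].
apply: lt_le_trans (lerD (cBA w) AMw).
rewrite subr_gt0 ltr_pM2r//; apply: le_lt_trans (_ : n.+1%:R * `|A - M| < c).
  by rewrite ler_wpM2r// ler_nat.
by rewrite mulrC -ltr_pdivlMr.
Qed.

(** At a minimum the Hessians differ by at least [eps], and the terms in [L] take back at most half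
    of this. So [Amat L v x] exceeds [Amat L u x] by [eps / 2] and would fall into [U]. *)
Lemma no_min_of_close_lower_order_terms (R : realType) n (U : set 'M[R]_n)
    (L : 'rV[R]_n * R * 'rV[R]_n -> 'M[R]_n) (D : set 'rV[R]_n)
    (u v : 'rV[R]_n -> R) (a x : 'rV[R]_n) (eps : R) :
  U `<=` @symm R n ->
  (forall M N : 'M[R]_n, U M -> posdef N -> U (M + N)) ->
  open D -> C2 D u -> C2 D v -> D x -> 0 < eps ->
  closure U (Amat L u x) -> (@symm R n `\` U) (Amat L v x) ->
  n%:R * `|L (x, u x, grad u x) - L (x, v x, grad v x)| <= eps / 2 ->
  let phi z := u z - v z - dot a z - eps / 2 * dot z z in
  ~ (\forall z \near x, phi x <= phi z).
Proof.
move=> Usymm Upos oD uC2 vC2 Dx eps0 UAu [symAv UAv] Lle phi.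
move=> /(grad_hessian_at_min oD uC2 vC2 Dx)[_ hess]; apply: UAv.
have e20 : 0 < eps / 2 by exact: divr_gt0.
apply: (closure_add_posdef Usymm Upos UAu symAv e20) => w.
set Lu := L _ in Lle; set Lv := L _ in Lle.
have -> : Amat L v x - Amat L u x =
    (hessian u x - hessian v x) - (Lu - Lv).
  by rewrite /Amat !opprD !opprK addrACA [- _ + hessian u x]addrC
    [Lv + _]addrC.
have -> : (w *m (hessian u x - hessian v x - (Lu - Lv)) *m w^T) ord0 ord0 =
    (w *m (hessian u x - hessian v x) *m w^T) ord0 ord0 -
    (w *m (Lu - Lv) *m w^T) ord0 ord0.
  by rewrite mulmxBr mulmxBl mxE [X in _ + X]mxE.
have := quadratic_form_le (Lu - Lv) w; rewrite ler_norml => /andP[_ Lw].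
apply: le_trans (lerB (hess w) (le_trans Lw (ler_wpM2r (dot_ge0 w) Lle))).
by rewrite -mulrBl [X in _ <= (X - _) * _]splitr addrK.
Qed.

(** * Local bounds, compactness, and minima away from the puncture *)

Lemma locally_lipschitz_ball (R : realType) (V W : normedModType R)
    (f : V -> W) (p : V) : locally_lipschitz f ->
  exists K r : R, [/\ 0 < K, 0 < r & forall y z, `|p - y| < r ->
    `|p - z| < r -> `|f y - f z| <= K * `|y - z|].
Proof.
move=> /(_ p)[A /nbhs_normP[r /= r0 rA] [M [_ HM]]].
(* The Lipschitz bound holds for every constant above the threshold [M], which may be negative. This
   choice is both positive and above [M]. *)
exists (Num.max M 0 + 1), r; split => //.
  by rewrite ltr_pwDr// le_max lexx orbT.
move=> y z py pz; apply: (HM _ _ (y, z)); last by split; exact: rA.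
by rewrite ltr_pwDr// le_max lexx.
Qed.

Lemma compact_annulus (R : realType) n (a b : R) :
  compact [set x : 'rV[R]_n | a <= `|x| <= b].
Proof.
apply: bounded_closed_compact.
  exists b; split; first exact: num_real.
  by move=> M bM x /= /andP[_ xb]; rewrite (le_trans xb)// ltW.
have -> : [set x : 'rV[R]_n | a <= `|x| <= b] =
    Num.norm @^-1` [set y : R | a <= y] `&` Num.norm @^-1` [set y : R | y <= b].
  by apply/seteqP; split=> x /= => [/andP[]|[-> ->]].
have cn := @norm_continuous R 'rV[R]_n.
apply: closedI.
  by apply: closed_comp => [x _|]; [exact: cn|exact: closed_ge].
by apply: closed_comp => [x _|]; [exact: cn|exact: closed_le].
Qed.

Lemma compact_pos_lower_bound (R : realType) (T : topologicalType)
    (K : set T) (f : T -> R) : compact K ->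
  (forall x, K x -> {for x, continuous f}) -> (forall x, K x -> 0 < f x) ->
  exists2 m, 0 < m & forall x, K x -> m <= f x.
Proof.
move=> cK cf f0; have [->|K0] := eqVneq K set0; first by exists 1.
have [||x] := @compact_EVT_min _ _ f K _ cK; first exact/set0P.
  by apply: continuous_in_subspaceT => x; rewrite inE; exact: cf.
rewrite inE => Kx xmin; exists (f x); first exact: f0.
by move=> y Ky; apply: xmin; rewrite inE.
Qed.

Lemma exists_pos_lt4 (R : realType) (a b c d : R) :
  0 < a -> 0 < b -> 0 < c -> 0 < d ->
  exists e : R, [/\ 0 < e, e < a, e < b, e < c & e < d].
Proof.
move=> a0 b0 c0 d0; pose m := Num.min (Num.min a b) (Num.min c d).
have m0 : 0 < m by rewrite !lt_min a0 b0 c0 d0.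
have : [/\ m <= a, m <= b, m <= c & m <= d].
  by split; rewrite /m !ge_min lexx ?orbT.
by case=> ? ? ? ?; exists (m / 2); split; lra.
Qed.

Lemma open_setD0 (R : realType) n (D : set 'rV[R]_n) : open D -> open (D `\ 0).
Proof.
move=> oD; apply: openI => //; apply: closed_openC.
exact/accessible_closed_set1/hausdorff_accessible/norm_hausdorff.
Qed.

Lemma near_dist_lt (R : realType) (V W : normedModType R) (f : V -> W) (x : V)
    (r : R) : {for x, continuous f} -> 0 < r ->
  \forall z \near x, `|f x - f z| < r.
Proof. by move=> /cvgrPdist_lt/(_ r) + r0 => /(_ r0). Qed.

Lemma grad_continuous (R : realType) n (D : set 'rV[R]_n) (f : 'rV[R]_n -> R)
    (x : 'rV[R]_n) : C2 D f -> D x -> {for x, continuous (grad f)}.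
Proof.
move=> fC2 Dx; have [_ fx _] := fC2 _ Dx.
apply: (proj2 (@cvgrPdist_le _ _ _ (nbhs x) (nbhs_filter x) (grad f) (grad f x))) => e e0.
suff : \forall z \near x, forall i, `|partial i f x - partial i f z| <= e.
  apply: filterS => z xz; apply/mx_norm_le => [|i j]; first exact: ltW.
  by rewrite !mxE.
apply: (@filter_forall _ _ (fun i z =>
  `|partial i f x - partial i f z| <= e) (nbhs x) _ _) => i.
by have [_ /cvgrPdist_le/(_ _ e0)] := fx i.
Qed.

Lemma jet_near (R : realType) n (D : set 'rV[R]_n) (v : 'rV[R]_n -> R)
    (r : R) : C2 D v -> D 0 -> 0 < r ->
  \forall x \near (0 : 'rV[R]_n),
    `|(0 : 'rV[R]_n, v 0, grad v 0) - (x, v x, grad v x)| < r.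
Proof.
move=> vC2 D0 r0; have [v0 _ _] := vC2 _ D0.
have gv0 := grad_continuous vC2 D0.
have vr := near_dist_lt v0 r0.
have gr := near_dist_lt gv0 r0.
have xr : \forall x \near (0 : 'rV[R]_n), `|0 - x| < r.
  by apply/nbhs_normP; exists r.
apply: filterS3 xr vr gr => x xr vr gr.
by rewrite prod_normE /= gt_max prod_normE /= gt_max xr vr gr.
Qed.

Lemma dot_continuous (R : realType) n (a : 'rV[R]_n) :
  continuous (fun x => dot a x).
Proof.
apply: continuous_big => [|i _ x]; first exact: add_continuous.
by apply: continuousM; [exact: cst_continuous|exact: coord_continuous].
Qed.

Lemma sqr_dot_continuous (R : realType) n :
  continuous (fun x : 'rV[R]_n => dot x x).
Proof.
apply: continuous_big => [|i _ x]; first exact: add_continuous.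
by apply: continuousM; exact: coord_continuous.
Qed.

(* The growth bound forbids minimizing sequences that tend to the puncture. *)
Lemma local_min_punctured_ball (R : realType) n (f : 'rV[R]_n -> R)
    (c delta : R) (x0 : 'rV[R]_n) : 0 < c ->
  (forall x, 0 < `|x| <= delta -> {for x, continuous f}) ->
  (forall x, 0 < `|x| <= delta -> - (c * `|x|) <= f x) ->
  (forall x, `|x| = delta -> 0 < f x) ->
  0 < `|x0| <= delta -> f x0 < 0 ->
  exists x, [/\ 0 < `|x| < delta, f x < 0 & \forall z \near x, f x <= f z].
Proof.
move=> c0 cf fc fd /andP[x00 x0d] fx0.
(* For [0 < |z| < rho] the growth bound gives [f z >= - c * rho >= f x0], so minimizing over
   [rho <= |x| <= delta] is enough. *)
pose rho := Num.min `|x0| (- f x0 / c) / 2.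
have rho0 : 0 < rho by rewrite divr_gt0// lt_min x00 divr_gt0// oppr_gt0.
have rhox : rho <= `|x0|.
  have : Num.min `|x0| (- f x0 / c) <= `|x0| by rewrite ge_min lexx.
  by move: x00 rho0; rewrite /rho; lra.
have rhof : c * rho <= - f x0.
  rewrite mulrC -ler_pdivlMr//.
  have : Num.min `|x0| (- f x0 / c) <= - f x0 / c by rewrite ge_min lexx orbT.
  by move: rho0; rewrite /rho; lra.
have [||y] := @EVT_min_rV _ _ f _ _ (@compact_annulus R n rho delta).
- by exists x0 => /=; rewrite rhox x0d.
- apply: continuous_in_subspaceT => x; rewrite inE /= => /andP[rx xd].
  by apply: cf; rewrite xd (lt_le_trans rho0).
rewrite inE /= => /andP[ry yd] ymin.
have fy : f y <= f x0 by apply: ymin; rewrite inE /= rhox x0d.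
have y0 : 0 < `|y| by exact: lt_le_trans ry.
have fy0 : f y < 0 by exact: le_lt_trans fx0.
have {}yd : `|y| < delta.
  rewrite lt_neqAle yd andbT; apply/negP => /eqP /fd.
  by rewrite ltNge ltW.
exists y; split; rewrite ?y0//.
(* This ball around [y] avoids the origin and stays within radius [delta]. It may still enter
   [|z| < rho], where the growth bound takes over. *)
apply/nbhs_normP; exists (Num.min `|y| (delta - `|y|)) => /=.
  by rewrite lt_min y0 subr_gt0.
move=> z; rewrite /ball_ /= lt_min => /andP[zy zd].
have z0 : 0 < `|z| by have := lerB_dist y z; lra.
have {}zd : `|z| <= delta.
  by have := lerB_dist z y; rewrite distrC; lra.
have [rz|zr] := leP rho `|z|; first by apply: ymin; rewrite inE /= rz zd.
apply: le_trans fy _; apply: le_trans (fc z _); last by rewrite z0 zd.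
rewrite lerNr; apply: le_trans rhof; rewrite ler_pM2l//; exact: ltW.
Qed.

(** * The linear lower bound for [u - v] near the puncture *)

(** The order of the constants matters. The radius [d] depends only on the data near
    [(0, v 0, grad v 0)] and makes the terms in [L] differ by [O(e d)], below the ellipticity gain
    for every [e < 1]. Only then is [e] chosen, from the minimum of [u - v] on the sphere of radius
    [d]. *)
Lemma linear_lower_bound (R : realType) n (Omega : set 'rV[R]_n)
    (U : set 'M[R]_n) (L : 'rV[R]_n * R * 'rV[R]_n -> 'M[R]_n)
    (u v : 'rV[R]_n -> R) :
  open Omega -> Omega 0 -> U `<=` @symm R n ->
  (forall M N : 'M[R]_n, U M -> posdef N -> U (M + N)) ->
  locally_lipschitz L -> C2 (Omega `\ 0) u -> C2 Omega v ->
  (forall x, (Omega `\ 0) x -> closure U (Amat L u x)) ->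
  (forall x, Omega x -> (@symm R n `\` U) (Amat L v x)) ->
  (forall x, (Omega `\ 0) x -> v x < u x) ->
  exists c delta : R, [/\ 0 < c, 0 < delta &
    forall x, 0 < `|x| <= delta -> c * `|x| <= u x - v x].
Proof.
move=> oO O0 Usymm Upos L_lip uC2 vC2 Au Av uv.
have oD := open_setD0 oO.
have vC2' : C2 (Omega `\ 0) v by move=> x [Ox _]; exact: vC2.
have [K [r [K0 r0 Llip]]] := locally_lipschitz_ball (0, v 0, grad v 0) L_lip.
have r20 : 0 < r / 2 by rewrite divr_gt0.
have /nbhs_normP[rho /= rho0 near0] : \forall x \near (0 : 'rV[R]_n),
    Omega x /\ `|(0 : 'rV[R]_n, v 0, grad v 0) - (x, v x, grad v x)| < r / 2.
  by apply: filterI; [exact: open_nbhs_nbhs|exact: (jet_near vC2 O0 r20)].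
(* On [|z| <= d] the paraboloid is at most [e d (n + 1) |z|], and the gradients will differ by at
   most [2 e d]. The constant [N] dominates both factors. *)
pose N : R := n%:R + 2.
have nN : n%:R <= N - 2 by rewrite /N addrK.
have n0 : 0 <= n%:R :> R by exact: ler0n.
have N0 : 0 < N by rewrite /N; lra.
have N10 : 0 <= N - 1 by lra.
have N1N : N - 1 <= N by lra.
have nN' : n%:R <= N by lra.
have r2r : r / 2 < r by lra.
have [d [d0 d1 drho dr dK]] : exists d, [/\ 0 < d, d < 1, d < rho,
    d < r / 2 / N & d < (2 * N * K * N)^-1].
  (* The bound by [rho] keeps the jet of [v] near the base point, [d * N < r / 2] keeps that of [u]
     in the Lipschitz ball, and the last bound caps the difference in [L] at [e / 2] after the
     factor [n]. *)
  by apply: exists_pos_lt4 => //; rewrite ?divr_gt0 ?invr_gt0 ?mulr_gt0.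
have {}dr : d * N < r / 2 by rewrite -ltr_pdivlMr.
have {}dK : N * (K * (d * N)) <= 1 / 2.
  move: dK; rewrite -[_^-1]div1r ltr_pdivlMr ?mulr_gt0// => /ltW.
  by lra.
have inD x : 0 < `|x| <= d -> (Omega `\ 0) x.
  move=> /andP[x0 xd]; split.
    have := near0 x; rewrite /ball_ /= sub0r normrN.
    by move=> /(_ (le_lt_trans xd drho))[].
  by move=> /= x0'; move: x0; rewrite x0' normr0 ltxx.
pose h x := u x - v x.
have ch x : 0 < `|x| <= d -> {for x, continuous h}.
  move=> /inD Dx; have [cu _ _] := uC2 _ Dx; have [cv _ _] := vC2' _ Dx.
  exact: continuousB.
have h0 x : 0 < `|x| <= d -> 0 < h x by move=> /inD/uv; rewrite subr_gt0.
have [m m0 hm] : exists2 m, 0 < m & forall x, d <= `|x| <= d -> m <= h x.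
  apply: (compact_pos_lower_bound (@compact_annulus R n d d)) => x /=
    /andP[dx xd]; [apply: ch|apply: h0]; by rewrite xd (lt_le_trans d0).
(* [e * N < m] makes [u - v] exceed the paraboloid on the sphere [|x| = d]. *)
have [e [e0 e1 em _ _]] : exists e, [/\ 0 < e, e < 1, e < m / N, e < 1 & e < 1].
  by apply: exists_pos_lt4 => //; exact: divr_gt0.
have {}em : e * N < m by rewrite -ltr_pdivlMr.
(* The bound on [dot a x] is assumed separately because [|a| <= e * d] alone would cost a factor
   [n]. It holds for the multiples of basis vectors used below. *)
have paraboloid (a : 'rV[R]_n) : (forall x, `|dot a x| <= e * d * `|x|) ->
    `|a| <= e * d ->
    forall x, 0 < `|x| <= d -> dot a x + e / 2 * dot x x <= h x.
  move=> da na x0 x0d.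
  pose phi z := u z - v z - dot a z - e / 2 * dot z z.
  have phiE z : phi z = h z - (dot a z + e / 2 * dot z z).
    by rewrite /phi /h opprD addrA.
  suff : 0 <= phi x0 by rewrite phiE subr_ge0.
  have quad z : `|z| <= d ->
      dot a z + e / 2 * dot z z <= e * d * (N - 1) * `|z|.
    move=> zd; have := da z; rewrite ler_norml => /andP[_ az].
    apply: le_trans (lerD az (_ : _ <= e * d * (N - 2) * `|z|)) _; last first.
      by rewrite le_eqVlt; apply/orP; left; apply/eqP; ring.
    have := dot_le_norm z z; rewrite ger0_norm ?dot_ge0// => zz.
    have zz' : n%:R * `|z| * `|z| <= d * (N - 2) * `|z|.
      by rewrite ler_wpM2r// mulrC ler_pM.
    apply: (@le_trans _ _ (e * dot z z)).
      by rewrite ler_wpM2r ?dot_ge0//; lra.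
    by rewrite -!mulrA ler_pM2l// !mulrA (le_trans zz).
  rewrite leNgt; apply/negP => phi0.
  (* Since [h > 0], [phi] is at least minus the paraboloid, which gives the growth bound with
     constant [e * N]. *)
  have [||||x [xd phix xmin]] :=
    @local_min_punctured_ball _ _ phi (e * N) d x0 _ _ _ _ x0d phi0.
  - exact: mulr_gt0.
  - move=> x xd; apply: continuousB; first (apply: continuousB; first exact: ch).
      exact: dot_continuous.
    by apply: continuousM; [exact: cst_continuous|exact: sqr_dot_continuous].
  - move=> x xd; rewrite phiE; have := h0 x xd.
    move: xd => /andP[x0' xd]; have := quad _ xd.
    suff : e * d * (N - 1) * `|x| <= e * N * `|x| by lra.
    rewrite ler_wpM2r// -mulrA ler_pM2l//.
    apply: (@le_trans _ _ (1 * (N - 1))); last by rewrite mul1r.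
    by rewrite ler_wpM2r// ltW.
  - move=> x xd; rewrite phiE; have := hm x; rewrite xd lexx => /(_ isT) mh.
    have := quad x; rewrite xd lexx => /(_ isT).
    suff : e * d * (N - 1) * d <= e * N by lra.
    rewrite -!mulrA ler_pM2l//; apply: (@le_trans _ _ ((N - 1) * d)).
      by rewrite ler_piMl ?mulr_ge0// ltW.
    apply: (@le_trans _ _ (N - 1)); last exact: N1N.
    by rewrite ler_piMr// ltW.
  move: (xd) => /andP[x1 /ltW x2].
  have xd' : 0 < `|x| <= d by rewrite x1 x2.
  have Dx := inD x xd'.
  have [gradE _] := grad_hessian_at_min oD uC2 vC2' Dx xmin.
  have edN : e * d + e * d <= e * (d * N).
    rewrite -mulrDr ler_pM2l// -mulr2n -mulr_natr ler_pM2l//.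
    by rewrite /N lerDr.
  (* From [phi x < 0], the positive number [u x - v x] lies below the paraboloid. The gradients
     differ by exactly [a + e *: x]. Hence the two jets are within [e d N]. *)
  have hx : `|u x - v x| <= e * (d * N).
    rewrite gtr0_norm ?h0//; have := quad _ x2.
    suff : e * d * (N - 1) * `|x| <= e * (d * N).
      by move: phix; rewrite phiE /h; lra.
    rewrite -!mulrA ler_pM2l// ler_pM2l// mulrC.
    apply: (@le_trans _ _ (1 * (N - 1))); last by rewrite mul1r.
    by rewrite ler_wpM2r// (le_trans x2 (ltW d1)).
  have gx : `|grad u x - grad v x| <= e * (d * N).
    rewrite gradE; apply: le_trans edN; apply: le_trans (ler_normD _ _) _.
    by rewrite lerD// normrZ gtr0_norm// ler_pM2l.
  have pq : `|(x, u x, grad u x) - (x, v x, grad v x)| <= e * (d * N).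
    rewrite prod_normE /= ge_max prod_normE /= ge_max subrr normr0 hx gx andbT.
    by rewrite andbT !mulr_ge0// ltW.
  have p0q : `|(0 : 'rV[R]_n, v 0, grad v 0) - (x, v x, grad v x)| < r / 2.
    have := near0 x; rewrite /ball_ /= sub0r normrN.
    by move=> /(_ (le_lt_trans x2 drho))[].
  (* Nothing is known about [u] at the origin, so its jet is reached through the jet of [v] at the
     same point. *)
  have p0p : `|(0 : 'rV[R]_n, v 0, grad v 0) - (x, u x, grad u x)| < r.
    apply: le_lt_trans (ler_distD (x, v x, grad v x) _ _) _.
    rewrite [ltRHS]splitr; apply: ltrD p0q _; rewrite distrC; apply: le_lt_trans pq _.
    by apply: le_lt_trans dr; rewrite ger_pMl ?mulr_gt0// ltW.
  have p0q' : `|(0 : 'rV[R]_n, v 0, grad v 0) - (x, v x, grad v x)| < r.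
    exact: lt_trans p0q r2r.
  apply: (no_min_of_close_lower_order_terms Usymm Upos oD uC2 vC2' Dx e0
    (Au _ Dx) (Av _ (proj1 Dx)) _ xmin).
  have LL := Llip _ _ p0p p0q'.
  apply: (@le_trans _ _ (N * (K * (e * (d * N))))).
    apply: (ler_pM n0 (normr_ge0 _) nN').
    by apply: le_trans LL _; rewrite ler_pM2l.
  have -> : N * (K * (e * (d * N))) = e * (N * (K * (d * N))) by ring.
  by apply: le_trans (ler_wpM2l (ltW e0) dK) _; rewrite mul1r.
have ed0 : 0 < e * d by exact: mulr_gt0.
exists (e * d), d; split => // x xd.
(* Taking [a] to be [e d] or [- e d] times a basis vector, and dropping the quadratic term, bounds
   every [e d |x_i|], hence [e d |x|], by [h x]. *)
have axis (s : R) i : `|s| = e * d -> s * x ord0 i <= h x.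
  move=> sed; have dotE z : dot (s *: delta_mx ord0 i) z = s * z ord0 i.
    by rewrite dotC dotZr dotC dot_deltal.
  have := paraboloid (s *: delta_mx ord0 i) _ _ x xd.
  rewrite dotE => /(_ _ _)/(le_trans _); apply.
  - by rewrite lerDl mulr_ge0 ?dot_ge0// divr_ge0// ltW.
  - by move=> z; rewrite dotE normrM sed ler_pM2l// entry_le_norm.
  - rewrite normrZ sed ger_pMr//; apply/mx_norm_le => // k l.
    by rewrite mxE; case: andP => _; rewrite ?normr1 ?normr0.
rewrite mulrC -ler_pdivlMr//; apply/mx_norm_le => [|k i].
  by rewrite divr_ge0// ltW// h0.
rewrite ord1 ler_pdivlMr// mulrC -[X in X * _](gtr0_norm ed0) -normrM.
rewrite ler_norml; apply/andP; split; last by apply: axis; rewrite gtr0_norm.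
by rewrite lerNl -mulNr; apply: axis; rewrite normrN gtr0_norm.
Qed.

(** * Euclidean balls compared with sup-norm balls *)

Lemma enorm_le_norm (R : realType) n (x : 'rV[R]_n) :
  enorm x <= n.+1%:R * `|x|.
Proof.
have x0 : 0 <= n.+1%:R * `|x| by rewrite mulr_ge0.
rewrite -(ger0_norm x0) -sqrtr_sqr ler_sqrt ?sqr_ge0//.
have := dot_le_norm x x; rewrite ger0_norm ?dot_ge0// => /le_trans; apply.
rewrite expr2 -mulrA mulrACA -[n.+1%:R * _ * _]mulrA ler_pM ?mulr_ge0// ?ler_nat//.
by rewrite ler_peMl ?mulr_ge0// ler1n.
Qed.

Lemma ball_sub_eball (R : realType) n (r : R) (x : 'rV[R]_n) :
  `|x| < r / n.+1%:R -> eball r x.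
Proof.
by rewrite ltr_pdivlMr// mulrC; apply: le_lt_trans; exact: enorm_le_norm.
Qed.

(** This places the minimum point of the hypothesis on [u] where the linear bound applies. The
    origin is interior to the ball, and the sup norm is at most the Euclidean one. *)
Lemma boundary_eball (R : realType) n (r : R) (x : 'rV[R]_n) : 0 < r ->
  boundary (eball r) x -> 0 < `|x| <= r.
Proof.
move=> r0 [clx intx]; apply/andP; split.
  rewrite normr_gt0; apply/eqP => x0; apply: intx; rewrite x0.
  change (\forall z \near (0 : 'rV[R]_n), eball r z).
  apply/nbhs_normP; exists (r / n.+1%:R) => /=; first exact: divr_gt0.
  by move=> y; rewrite /ball_ /= sub0r normrN; exact: ball_sub_eball.
have cn := @norm_continuous R 'rV[R]_n.
have cb : closed (Num.norm @^-1` [set t : R | t <= r] : set 'rV[R]_n).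
  by apply: closed_comp => [y _|]; [exact: cn|exact: closed_le].
move: x clx {intx}; change (closure (eball r) `<=` [set y : 'rV[R]_n | `|y| <= r]).
rewrite [X in _ `<=` X](closure_id _).1//; apply: closure_subset => x /= /ltW.
exact: le_trans (norm_le_enorm x).
Qed.

(** * From the linear bound to the lower limit *)

Theorem theorem1p5 (R : realType) (n : nat) (n_ge2 : (2 <= n)%N)
  (Omega : set 'rV[R]_n) (Omega_domain : domain Omega) (Omega0 : Omega 0)
  (U : set 'M[R]_n) (U_open : open_in_symm U)
  (U_posdef : forall M N : 'M[R]_n, U M -> posdef N -> U (M + N))
  (L : 'rV[R]_n * R * 'rV[R]_n -> 'M[R]_n)
  (L_symm : forall p, symm (L p)) (L_lip : locally_lipschitz L)
  (u : 'rV[R]_n -> R) (u_C2 : C2 (Omega `\ 0) u)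
  (rbar : R) (rbar_gt0 : 0 < rbar) (rbar_Omega : eball rbar `<=` Omega)
  (u_min : forall (V : 'rV[R]_n) (r : R), 0 < r < rbar ->
    inf_eq_min (fun x => u x + dot V x) (eball r `\ 0) (boundary (eball r)))
  (v : 'rV[R]_n -> R) (v_C2 : C2 Omega v)
  (Au : forall x, (Omega `\ 0) x -> closure_in_symm U (Amat L u x))
  (Av : forall x, Omega x -> (@symm R n `\` U) (Amat L v x))
  (u_gt_v : forall x, (Omega `\ 0) x -> v x < u x) :
  (0 < limf_einf (fun x => (u x - v x)%R%:E) (0%R : 'rV[R]_n)^')%E.
Proof.
have [_ _ Omega_open] := Omega_domain.
have Usymm : U `<=` @symm R n by have [W _ ->] := U_open => M [].
have [c [delta [c0 delta0 cdelta]]] := linear_lower_bound Omega_open Omega0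
  Usymm U_posdef L_lip u_C2 v_C2 (fun x Dx => proj1 (Au x Dx)) Av u_gt_v.
(* The Taylor error of [v] may use up half of the linear bound [c |x|]. *)
have c20 : 0 < c / 2 by exact: divr_gt0.
have /nbhs_normP[rho /= rho0 v_expand] : \forall x \near (0 : 'rV[R]_n),
    `|v (0 + x) - v 0 - dot x (grad v 0)| <= c / 2 * `|x|.
  apply: first_order_expansion => // [|i]; last first.
    by have [_ /(_ i)[]] := v_C2 _ Omega0.
  apply: filterS (open_nbhs_nbhs (conj Omega_open Omega0)) => z Oz i.
  by have [_ /(_ i)[]] := v_C2 _ Oz.
have [r [r0 rdelta rrho rrbar _]] := exists_pos_lt4 delta0 rho0 rbar_gt0 rbar_gt0.
have {}v_expand x : `|x| <= r ->
    `|v x - v 0 - dot x (grad v 0)| <= c / 2 * `|x|.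
  move=> xr; have := v_expand x; rewrite /ball_ /= sub0r normrN add0r; apply.
  exact: le_lt_trans rrho.
pose w x := u x + dot (- grad v 0) x.
have dotV x : dot (- grad v 0) x = - dot x (grad v 0).
  by rewrite dotC -scaleN1r dotZr mulN1r.
(* Subtracting the linear part of [v] leaves a comparison with the constant [v 0]. As [r] is fixed,
   so is the nonzero point [y], and [k] is a positive constant. *)
have [|y [yB _] w_inf] := u_min (- grad v 0) r; first by rewrite r0.
have /andP[y0 yr] := boundary_eball r0 yB.
pose k := c / 2 * `|y|.
have k0 : 0 < k by exact: mulr_gt0.
(* [u y >= v y + c |y|], and [v y - y . grad v 0 >= v 0 - c |y| / 2]. *)
have wy : v 0 + k <= w y.
  rewrite /w dotV /k.
  have := v_expand _ yr; rewrite ler_norml => /andP[vy _].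
  have := cdelta y; rewrite y0 (le_trans yr (ltW rdelta)) => /(_ isT).
  move: vy; move: (dot _ _) (u y) (v y) (v 0) `|y|; clear.
  by move=> *; lra.
have ww x : (eball r `\ 0) x -> w y <= w x.
  move=> xB; rewrite -lee_fin -w_inf; apply: ereal_inf_lbound.
  by exists x.
(* The first radius puts [x] in the Euclidean ball of radius [r]. The second makes the Taylor error
   of [v] at [x] at most [k / 2], half of the gain. *)
have t0 : 0 < Num.min (r / n.+1%:R) (`|y| / 2).
  by rewrite lt_min !divr_gt0.
have hk x : `|x| < Num.min (r / n.+1%:R) (`|y| / 2) -> x != 0 ->
    k / 2 <= u x - v x.
  rewrite lt_min => /andP[/ball_sub_eball xr xy] x0.
  have /ww wx : (eball r `\ 0) x by split=> //; exact/eqP.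
  have xr' : `|x| <= r by rewrite (le_trans (norm_le_enorm x))// ltW.
  have := v_expand _ xr'; rewrite ler_norml => /andP[_ vx].
  have cx : c / 2 * `|x| <= k / 2 by rewrite /k -[leRHS]mulrA ler_pM2l// ltW.
  move: (le_trans wy wx) vx cx; rewrite {1}/w dotV.
  by move: (dot _ _) (u x) (v x) (v 0) (c / 2 * `|x|); clear => *; lra.
apply: (@lt_le_trans _ _ (k / 2)%:E); first by rewrite lte_fin divr_gt0.
rewrite limf_einfE.
(* The lower limit is a supremum of infima over punctured neighbourhoods, so this single one
   suffices. *)
pose A := [set x : 'rV[R]_n | `|x| < Num.min (r / n.+1%:R) (`|y| / 2) /\ x != 0].
apply: (@le_trans _ _ (ereal_inf ((fun x => (u x - v x)%:E) @` A))).
  by apply/ereal_infP => _ [x [xt x0] <-]; rewrite lee_fin; exact: hk.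
apply: ereal_sup_ubound; exists A => //.
change (\forall x \near (0 : 'rV[R]_n), x != 0 -> A x).
apply/nbhs_normP; exists (Num.min (r / n.+1%:R) (`|y| / 2)) => //= x.
by rewrite /ball_ /= sub0r normrN => xt x0; split.
Qed.
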